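(* For every integer $k\ge1$, $$\sum_{n=0}^{\infty}RD_3^{3,3}\left(3^kn+\frac{3^k+1}{2}\right)q^n\equiv0\pmod{3^{k+1}},$$ i.e. $RD_3^{3,3}\left(3^kn+\frac{3^k+1}{2}\right)\equiv0\pmod{3^{k+1}}$ for all integers $k\ge1$ and $n\ge0$.
   Context: For $r\ge1$, $E_r=\prod_{n=1}^{\infty}(1-q^{nr})$, $|q|<1$ (or as a formal power series in $q$). For positive integers $\ell,t,k$, $RD_k^{\ell,t}(n)$ denotes the number of partitions of $n$ in which each part carries one of $k$ colors, no part is divisible by $\ell$, and each colored part appears fewer than $t$ times; its generating function is $$\sum_{n=0}^{\infty}RD_k^{\ell,t}(n)q^n=\left(\frac{E_\ell E_t}{E_1E_{\ell t}}\right)^k.$$ In particular $\sum_{n\ge0}RD_3^{3,3}(n)q^n=\left(\frac{E_3^2}{E_1E_9}\right)^3$. A congruence between power series means congruence of all coefficients. *)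

(* Defs.v *)
From mathcomp Require Import all_boot.

Set Implicit Arguments.
Unset Strict Implicit.
Unset Printing Implicit Defensive.

(* A partition of n whose parts carry one of k colors is encoded by its
   multiplicities: [m (i, c)] is the number of occurrences of the part [i.+1]
   in color [c].  The parts of a partition of n are among 1, ..., n, so i
   ranges over 'I_n; the value type 'I_t says that each colored part appears
   fewer than t times. *)
Definition RDset (k l t n : nat) : {set {ffun 'I_n * 'I_k -> 'I_t}} :=
  [set m : {ffun 'I_n * 'I_k -> 'I_t} |
     (\sum_(i < n) \sum_(c < k) m (i, c) * i.+1 == n)
     && [forall i : 'I_n, forall c : 'I_k,
           (l %| i.+1) ==> (m (i, c) == 0 :> nat)]].

(* RD_k^{l,t}(n) *)
Definition RD (k l t n : nat) : nat := #|RDset k l t n|.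

(* Main.v *)
Require Import Defs.
From HB Require Import structures.
From mathcomp Require Import all_boot all_algebra boolp ring zify.

(** Write E_r for the product of the 1 - q^(rn), n >= 1, let U_r send a series
    to the series of its coefficients of index 3n + r, and V be q -> q^3.  The
    numbers in the theorem are the coefficients of U_1^(k-1) U_2 F, where
    F = E_3^6 / (E_1 E_9)^3 is the generating function of RD 3 3 3.  So it is
    enough to exhibit a family of series that contains U_2 F up to a factor 9
    and that U_1 maps into 3 times itself.

    Everything follows from the trisection of E_1^3.  Jacobi's identity
        E_1^3 = sum over j >= 0 of (-1)^j (2j+1) q^(j(j+1)/2)
    shows that E_1^3 = a - b with a = V(P) for some series P, b = 3 q E_9^3
    ([euler_cube]): j(j+1)/2 is never 2 mod 3, and it is 1 mod 3 exactly when
    j = 3m+1, where it equals 1 + 9 m(m+1)/2.  Multiplying E_1(q), E_1(zq),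
    E_1(z^2 q) with z a primitive cube root of unity gives
    P^3 = K + 27 q E_3^9, K = E_1^12 / E_3^3 ([cubenorm_euler]), and the
    cofactor of a - b in a^3 - b^3 = V(K) gives
        1 / E_1^3 = (a^2 + ab + b^2) / V(K)      ([cube_cofactor]).

    With y = (E_3/E_1)^6 this yields U_2 F = 9 y ([Uop2_RDgf]).  Put
    w = 27 q (E_3/E_1)^12 = 27 q E_3^9 / K, so that P^3 = K (1 + w).  A power
    y w^j is, up to factors in q^3, equal to (27q)^j (a^2 + ab + b^2)^(2+4j);
    in each monomial q^j a^n b^m kept by U_1 the exponent j + m is 1 mod 3, the
    powers of P that remain are powers of P^3, and counting powers of 3 leaves
    3 y w^l (1 + w)^N times an integer.  Hence U_1 maps y Z[w] into 3 y Z[w]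
    ([Uop1_stable]), and U_1^(k-1) U_2 F lies in 3^(k+1) y Z[w].

    Infinite products are handled through congruences modulo q^m between a
    product and its finite truncations, and the product identities are proved
    for the truncations, by induction on the number of factors. *)

Set Implicit Arguments.
Unset Strict Implicit.
Unset Printing Implicit Defensive.

Import GRing.Theory.
Local Open Scope ring_scope.

(** * The ring of formal power series *)

(** A record rather than a bare function type, which already carries the
    pointwise ring structure. *)
Record fps (R : Type) := Fps { coefs :> nat -> R }.

Lemma fpsP (R : Type) (f g : fps R) : f =1 g -> f = g.
Proof. by case: f g => f [g] /= fg; congr Fps; apply/funext. Qed.

HB.instance Definition _ (R : Type) := gen_eqMixin (fps R).
HB.instance Definition _ (R : Type) := gen_choiceMixin (fps R).

Section FpsRing.
Variable R : comNzRingType.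
Implicit Types f g h : fps R.

Definition fps_add f g := Fps (fun n => f n + g n).
Definition fps_opp f := Fps (fun n => - f n).
Definition fps_const c : fps R := Fps (fun n => if n is 0%N then c else 0).
Definition fps_mul f g := Fps (fun n => \sum_(i < n.+1) f i * g (n - i)%N).

Fact fps_addA : associative fps_add.
Proof. by move=> f g h; apply/fpsP => n /=; rewrite addrA. Qed.
Fact fps_addC : commutative fps_add.
Proof. by move=> f g; apply/fpsP => n /=; rewrite addrC. Qed.
Fact fps_add0 : left_id (fps_const 0) fps_add.
Proof. by move=> f; apply/fpsP => -[|n] /=; rewrite add0r. Qed.
Fact fps_addN : left_inverse (fps_const 0) fps_opp fps_add.
Proof. by move=> f; apply/fpsP => -[|n] /=; rewrite addNr. Qed.
HB.instance Definition _ :=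
  GRing.isZmodule.Build (fps R) fps_addA fps_addC fps_add0 fps_addN.

Definition trunc N f : {poly R} := \poly_(i < N) f i.

Lemma coef_trunc N f i : (i < N)%N -> (trunc N f)`_i = f i.
Proof. by move=> ltiN; rewrite coef_poly ltiN. Qed.

(** Coefficient n of a product only involves coefficients up to n, so the ring
    laws, and below the multiplicativity of q -> q^3, are inherited from
    polynomials. *)
Lemma fps_mul_poly (p r : {poly R}) f g n :
    (forall i, (i <= n)%N -> p`_i = f i) -> (forall i, (i <= n)%N -> r`_i = g i) ->
  fps_mul f g n = (p * r)`_n.
Proof.
move=> pf rg; rewrite coefM; apply: eq_bigr => -[i /= lein] _.
by rewrite pf ?rg ?leq_subr.
Qed.

Fact fps_mulC : commutative fps_mul.
Proof.
move=> f g; apply/fpsP => n; have tE h := @coef_trunc n.+1 h.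
by rewrite !(fps_mul_poly (tE _) (tE _)) mulrC.
Qed.
Fact fps_mulA : associative fps_mul.
Proof.
have aux f g h n :
    fps_mul (fps_mul f g) h n = (trunc n.+1 f * trunc n.+1 g * trunc n.+1 h)`_n.
  apply: fps_mul_poly => i lein; last exact: coef_trunc.
  by rewrite -(@fps_mul_poly _ _ f g) // => j leji; apply: coef_trunc; lia.
move=> f g h; apply/fpsP => n.
by rewrite (fps_mulC f) !aux mulrC mulrA.
Qed.
Fact fps_mul1 : left_id (fps_const 1) fps_mul.
Proof.
move=> f; apply/fpsP => n /=; rewrite big_ord_recl mul1r subn0.
by rewrite big1 ?addr0 // => i _; rewrite mul0r.
Qed.
Fact fps_mulDl : left_distributive fps_mul fps_add.
Proof.
move=> f g h; apply/fpsP => n /=; rewrite -big_split /=.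
by apply: eq_bigr => i _; rewrite mulrDl.
Qed.
Fact fps_1_neq0 : fps_const 1 != fps_const 0.
Proof. by apply/eqP => /(congr1 (@coefs R))/(congr1 (@^~ 0%N))/eqP; rewrite /= oner_eq0. Qed.
HB.instance Definition _ := GRing.Zmodule_isComNzRing.Build (fps R)
  fps_mulA fps_mulC fps_mul1 fps_mulDl fps_1_neq0.

(** Units are the invertible elements, with an inverse chosen classically; the
    usable criterion is [fps_unit1]. *)
Definition fps_unit := [pred f : fps R | `[< exists g, g * f = 1 >]].
Definition fps_inv f : fps R :=
  if pselect (exists g, g * f = 1) is left gP then projT1 (cid gP) else f.

Fact fps_mulVf : {in fps_unit, left_inverse 1 fps_inv *%R}.
Proof.
move=> f /asboolP fP; rewrite /fps_inv.
by case: pselect => // gP; case: cid.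
Qed.
Fact fps_unitPl f g : g * f = 1 -> fps_unit f.
Proof. by move=> gf; apply/asboolP; exists g. Qed.
Fact fps_inv_out : {in [predC fps_unit], fps_inv =1 id}.
Proof. by move=> f /asboolPn fN; rewrite /fps_inv; case: pselect. Qed.
HB.instance Definition _ := GRing.ComNzRing_hasMulInverse.Build (fps R)
  fps_mulVf fps_unitPl fps_inv_out.

Lemma coefsD f g n : (f + g) n = f n + g n. Proof. by []. Qed.
Lemma coefsN f n : (- f) n = - f n. Proof. by []. Qed.
Lemma coefs0 n : (0 : fps R) n = 0. Proof. by case: n. Qed.
Lemma coefs1 n : (1 : fps R) n = (n == 0%N)%:R. Proof. by case: n. Qed.
Lemma coefsM f g n : (f * g) n = \sum_(i < n.+1) f i * g (n - i)%N.
Proof. by []. Qed.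
Lemma coefs_sum I r (P : pred I) (F : I -> fps R) n :
  (\sum_(i <- r | P i) F i) n = \sum_(i <- r | P i) F i n.
Proof. exact: (big_morph (fun f : fps R => f n) (fun f g => coefsD f g n) (coefs0 n)). Qed.
Lemma coefsMn f m n : (f *+ m) n = f n *+ m.
Proof. by elim: m => [|m IH]; rewrite ?mulr0n ?coefs0 // !mulrS coefsD IH. Qed.

Definition fpsX : fps R := Fps (fun n => (n == 1%N)%:R).
Local Notation q := fpsX.

Lemma coefsXM f n : (q * f) n = if n is m.+1 then f m else 0.
Proof.
case: n => [|n]; rewrite coefsM big_ord_recl mul0r add0r ?big_ord0 //.
rewrite big_ord_recl mul1r subn1 big1 ?addr0 // => i _; exact: mul0r.
Qed.
Lemma coefsXnM m f n : (q ^+ m * f) n = if (m <= n)%N then f (n - m)%N else 0.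
Proof.
elim: m n => [|m IH] n; first by rewrite mul1r subn0.
by rewrite exprS -mulrA coefsXM; case: n => [|n] //; rewrite IH.
Qed.
Lemma coefsXn m n : (q ^+ m) n = (n == m)%:R.
Proof.
by rewrite -[_ ^+ m]mulr1 coefsXnM coefs1; case: leqP => [?|/ltn_eqF-> //]; congr (_%:R); lia.
Qed.

(** Congruence modulo q^m. *)
Definition eqX (m : nat) f g := forall n, (n < m)%N -> f n = g n.

Lemma eqX_refl m f : eqX m f f. Proof. by []. Qed.
Lemma eqX_sym m f g : eqX m f g -> eqX m g f.
Proof. by move=> fg n ltnm; rewrite fg. Qed.
Lemma eqX_trans m f g h : eqX m f g -> eqX m g h -> eqX m f h.
Proof. by move=> fg gh n ltnm; rewrite fg // gh. Qed.
Lemma eqX_leq m p f g : (m <= p)%N -> eqX p f g -> eqX m f g.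
Proof. by move=> lemp fg n ltnm; rewrite fg // (leq_trans ltnm). Qed.
Lemma eqX_all f g : (forall m, eqX m f g) -> f = g.
Proof. by move=> fg; apply/fpsP => n; apply: (fg n.+1). Qed.
Lemma eqXD m f f' g g' : eqX m f f' -> eqX m g g' -> eqX m (f + g) (f' + g').
Proof. by move=> ff' gg' n ltnm; rewrite !coefsD ff' ?gg'. Qed.
Lemma eqXN m f f' : eqX m f f' -> eqX m (- f) (- f').
Proof. by move=> ff' n ltnm; rewrite !coefsN ff'. Qed.
Lemma eqXM m f f' g g' : eqX m f f' -> eqX m g g' -> eqX m (f * g) (f' * g').
Proof.
move=> ff' gg' n ltnm; rewrite !coefsM; apply: eq_bigr => -[i lein] _ /=.
by rewrite ff' ?gg' //; lia.
Qed.
Lemma eqXX m p f f' : eqX m f f' -> eqX m (f ^+ p) (f' ^+ p).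
Proof. by move=> ff'; elim: p => // p IH; rewrite !exprS; apply: eqXM. Qed.
Lemma eqX_sum m I r (P : pred I) (F G : I -> fps R) :
  (forall i, P i -> eqX m (F i) (G i)) ->
  eqX m (\sum_(i <- r | P i) F i) (\sum_(i <- r | P i) G i).
Proof. by move=> FG n ltnm; rewrite !coefs_sum; apply: eq_bigr => i /FG ->. Qed.
Lemma eqX_Xn m p f g : eqX m f g -> eqX (p + m) (q ^+ p * f) (q ^+ p * g).
Proof. by move=> fg n ltn; rewrite !coefsXnM; case: leqP => // ?; apply: fg; lia. Qed.
Lemma eqX_Xn0 m p f : (m <= p)%N -> eqX m (q ^+ p * f) 0.
Proof. by move=> lemp n ltn; rewrite coefsXnM coefs0 ifF //; lia. Qed.

(** The inverse is the geometric series in 1 - f, which converges because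
    (1 - f)^n is divisible by q^n. *)
Lemma fps_unit1 f : f 0%N = 1 -> f \is a GRing.unit.
Proof.
move=> f0; have geoE n : eqX n ((1 - f) ^+ n) 0.
  pose h : fps R := Fps (fun n => (1 - f) n.+1).
  have ->: 1 - f = q * h.
    by apply/fpsP => -[|m]; rewrite coefsXM // coefsD coefsN f0 subrr.
  by rewrite exprMn; apply: eqX_Xn0.
pose g : fps R := Fps (fun n => (\sum_(i < n.+1) (1 - f) ^+ i) n).
have gE n : eqX n g (\sum_(i < n) (1 - f) ^+ i).
  elim: n => // n IH m; rewrite ltnS leq_eqVlt => /predU1P[-> //|ltmn].
  by rewrite IH // big_ord_recr coefsD geoE ?coefs0 ?addr0.
suff gf: g * f = 1 by apply/unitrP; exists g; split; rewrite // mulrC.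
apply: eqX_all => n; apply: eqX_trans (eqXM (gE n) (@eqX_refl n f)) _.
have ->: (\sum_(i < n) (1 - f) ^+ i) * f = 1 - (1 - f) ^+ n.
  have := subrXX 1 (1 - f) n; rewrite expr1n subKr => ->.
  by rewrite mulrC; congr (_ * _); apply: eq_bigr => i _; rewrite expr1n mul1r.
rewrite -[X in eqX _ _ X]subr0; apply: eqXD => //; exact/eqXN/geoE.
Qed.

(** * Trisection of a series and the cubic norm *)

Definition Vop f : fps R := Fps (fun n => if (3 %| n)%N then f (n %/ 3)%N else 0).
Definition Uop r f : fps R := Fps (fun n => f (3 * n + r)%N).

Lemma coefsV f n : Vop f n = if (3 %| n)%N then f (n %/ 3)%N else 0.
Proof. by []. Qed.

Lemma coefsU r f n : Uop r f n = f (3 * n + r)%N. Proof. by []. Qed.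

Fact Uop_additive r : zmod_morphism (Uop r).
Proof. by move=> f g; apply/fpsP. Qed.
HB.instance Definition _ r :=
  GRing.isZmodMorphism.Build (fps R) (fps R) (Uop r) (Uop_additive r).

Fact Vop_additive : zmod_morphism Vop.
Proof.
move=> f g; apply/fpsP => n; rewrite coefsD coefsN /=.
by case: ifP => // _; rewrite subr0.
Qed.
HB.instance Definition _ :=
  GRing.isZmodMorphism.Build (fps R) (fps R) Vop Vop_additive.

Fact Vop_multiplicative : monoid_morphism Vop.
Proof.
split.
  apply/fpsP => n; rewrite coefsV !coefs1.
  by case: ifP => n3; [congr (_%:R) | rewrite -[0]/(0%:R); congr (_%:R)]; lia.
move=> f g; apply/fpsP => n.
have VE h i : (i <= n)%N -> (trunc n.+1 h \Po 'X^3)`_i = Vop h i.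
  by move=> lein; rewrite coef_comp_poly_Xn //= coef_trunc //; lia.
rewrite [RHS](fps_mul_poly (VE f) (VE g)) -rmorphM coef_comp_poly_Xn //=.
case: ifP => // _; apply: fps_mul_poly => i lein; rewrite coef_trunc //; lia.
Qed.
HB.instance Definition _ :=
  GRing.isMonoidMorphism.Build (fps R) (fps R) Vop Vop_multiplicative.

Lemma VopX : Vop q = q ^+ 3.
Proof.
apply/fpsP => n; rewrite coefsXn /=.
by case: ifP => ?; rewrite -?[0]/(0%:R); congr (_%:R); lia.
Qed.

Lemma VopXn n : Vop (q ^+ n) = q ^+ (3 * n).
Proof. by rewrite rmorphXn /= VopX exprM. Qed.

Lemma coefsV0 f n : Vop f (3 * n)%N = f n.
Proof. by rewrite /= dvdn_mulr // mulKn. Qed.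
Lemma coefsV1 f n : Vop f (3 * n).+1 = 0.
Proof. by rewrite /= ifF //; lia. Qed.
Lemma coefsV2 f n : Vop f (3 * n).+2 = 0.
Proof. by rewrite /= ifF //; lia. Qed.

Lemma mod3_cases n : exists m, [\/ n = (3 * m)%N, n = (3 * m).+1 | n = (3 * m).+2].
Proof.
exists (n %/ 3)%N; have: (n %% 3 < 3)%N by rewrite ltn_pmod.
by case E: (n %% 3)%N => [|[|[|]]] // _; [apply: Or31 | apply: Or32 | apply: Or33]; lia.
Qed.

(** Uniqueness of the decomposition f = f0(q^3) + q f1(q^3) + q^2 f2(q^3): the
    way in which the operators [Uop r] are computed in what follows. *)
Lemma trisectE f f0 f1 f2 : f = Vop f0 + q * Vop f1 + q ^+ 2 * Vop f2 ->
  [/\ Uop 0 f = f0, Uop 1 f = f1 & Uop 2 f = f2].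
Proof.
move=> ->; split; apply/fpsP => n; rewrite coefsU ?addn0 ?addn1 ?addn2 !coefsD coefsXM coefsXnM.
- rewrite coefsV0; case: n => [|n]; rewrite ?muln0 ?addr0 //.
  by rewrite mulnS !addSn add0n coefsV2 subSS subn1 coefsV1 !addr0.
- rewrite coefsV0 coefsV1 add0r; case: n => [|n]; rewrite ?muln0 ?addr0 //.
  by rewrite mulnS !addSn add0n subSS subn1 coefsV2 addr0.
- by rewrite coefsV1 coefsV2 !add0r subSS subn1 coefsV0.
Qed.

Lemma trisection f : f = Vop (Uop 0 f) + q * Vop (Uop 1 f) + q ^+ 2 * Vop (Uop 2 f).
Proof.
set g := RHS; have [E0 E1 E2] := trisectE (erefl g).
apply/fpsP => n; have [m [->|->|->]] := mod3_cases n.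
- by have := congr1 (fun h : fps R => h m) E0; rewrite !coefsU addn0.
- by have := congr1 (fun h : fps R => h m) E1; rewrite !coefsU addn1.
- by have := congr1 (fun h : fps R => h m) E2; rewrite !coefsU addn2.
Qed.

Lemma UopVM r f g : (r < 3)%N -> Uop r (Vop f * g) = f * Uop r g.
Proof.
have fgE : Vop f * g = Vop (f * Uop 0 g) + q * Vop (f * Uop 1 g)
                      + q ^+ 2 * Vop (f * Uop 2 g).
  by rewrite {1}[g]trisection !rmorphM /=; ring.
by have [E0 E1 E2] := trisectE fgE; case: r => [|[|[|]]].
Qed.

Lemma Uop_XV r s f : (r < 3)%N -> (s < 3)%N ->
  Uop r (q ^+ s * Vop f) = if r == s then f else 0.
Proof.
have aux f0 f1 f2 := @trisectE _ f0 f1 f2 erefl.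
have := aux f 0 0; have := aux 0 f 0; have := aux 0 0 f.
rewrite !raddf0 !mulr0 !addr0 !add0r => -[A0 A1 A2] [B0 B1 B2] [C0 C1 C2].
by case: r => [|[|[|]]] // _; case: s => [|[|[|]]] // _; rewrite ?mul1r ?expr1.
Qed.

Lemma Uop_XnV r n f : (r < 3)%N ->
  Uop r (q ^+ n * Vop f) = if (n %% 3 == r)%N then q ^+ (n %/ 3) * f else 0.
Proof.
move=> ltr3; rewrite {1}(divn_eq n 3) exprD mulnC exprM -VopX -rmorphXn /=.
by rewrite -mulrA UopVM // Uop_XV ?ltn_pmod // eq_sym; case: ifP; rewrite ?mulr0.
Qed.

Lemma Uop_Xn r n : (r < 3)%N ->
  Uop r (q ^+ n) = if (n %% 3 == r)%N then q ^+ (n %/ 3) else 0.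
Proof. by move=> ltr; have := Uop_XnV n 1 ltr; rewrite rmorph1 !mulr1. Qed.

Lemma Uop_mul f g :
  let f0 := Uop 0 f in let f1 := Uop 1 f in let f2 := Uop 2 f in
  let g0 := Uop 0 g in let g1 := Uop 1 g in let g2 := Uop 2 g in
  [/\ Uop 0 (f * g) = f0 * g0 + q * (f1 * g2 + f2 * g1),
      Uop 1 (f * g) = f0 * g1 + f1 * g0 + q * (f2 * g2) &
      Uop 2 (f * g) = f0 * g2 + f1 * g1 + f2 * g0].
Proof.
move=> f0 f1 f2 g0 g1 g2.
apply: trisectE.
rewrite {1}[f]trisection {1}[g]trisection !(rmorphM, rmorphD) /= VopX.
by rewrite -/f0 -/f1 -/f2 -/g0 -/g1 -/g2; ring.
Qed.

(** Multiplication by f on the series in q, a free module of rank 3 over the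
    series in q^3, has a determinant; [norm3 f] is that determinant with q^3
    renamed q.  Over a ring with a primitive cube root of unity z,
    V (norm3 f) is the product of f(q), f(zq) and f(z^2 q); the present form
    needs no such root. *)
Definition norm3 f : fps R :=
  Uop 0 f ^+ 3 + q * Uop 1 f ^+ 3 + q ^+ 2 * Uop 2 f ^+ 3
  - 3%:R * q * (Uop 0 f * Uop 1 f * Uop 2 f).

Lemma norm3M f g : norm3 (f * g) = norm3 f * norm3 g.
Proof. by rewrite /norm3; have [-> -> ->] := Uop_mul f g; ring. Qed.

Lemma norm3V f : norm3 (Vop f) = f ^+ 3.
Proof.
have fE : Vop f = Vop f + q * Vop 0 + q ^+ 2 * Vop 0 by rewrite !raddf0; ring.
by rewrite /norm3; have [-> -> ->] := trisectE fE; ring.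
Qed.

Lemma norm3_1BX n : ~~ (3 %| n)%N -> norm3 (1 - q ^+ n) = 1 - q ^+ n.
Proof.
move=> n3; have UX r : (r < 3)%N -> Uop r (1 - q ^+ n) =
    (if r == 0%N then 1 else 0) - if (n %% 3 == r)%N then q ^+ (n %/ 3) else 0.
  move=> ltr; rewrite raddfB; congr (_ - _).
    by have := Uop_Xn 0 ltr; rewrite mod0n div0n !expr0 eq_sym.
  exact: Uop_Xn.
rewrite /norm3 !UX //=.
have ->: q ^+ n = (q ^+ (n %/ 3)) ^+ 3 * q ^+ (n %% 3).
  by rewrite -exprM -exprD -divn_eq.
have: (n %% 3 < 3)%N by rewrite ltn_pmod.
move: n3; rewrite /dvdn; case: (n %% 3)%N => [|[|[|]]] // _ _ /=; ring.
Qed.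

Lemma eqX_Uop r m f g : (r < 3)%N -> eqX (3 * m) f g -> eqX m (Uop r f) (Uop r g).
Proof. by move=> ltr fg n ltnm; apply: fg; lia. Qed.

Lemma eqX_Vop m f g : eqX m f g -> eqX m (Vop f) (Vop g).
Proof. by move=> fg n ltnm /=; case: ifP => // _; apply: fg; lia. Qed.

(** The factor 3 reflects the renaming of q^3 as q. *)
Lemma eqX_norm3 m f g : eqX (3 * m) f g -> eqX m (norm3 f) (norm3 g).
Proof.
move=> fg; have fgr r : (r < 3)%N -> eqX m (Uop r f) (Uop r g).
  by move=> ltr; apply: eqX_Uop.
by do ![apply: eqXD | apply: eqXN | apply: eqXM | apply: eqXX | apply: fgr].
Qed.

End FpsRing.

(** * Jacobi's identity for the cube of the Euler product *)

Section Euler.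
Variable R : comNzRingType.
Local Notation q := (fpsX R).

Definition qpoch n : fps R := \prod_(i < n) (1 - q ^+ i.+1).
(** The infinite product E_1: by [qpoch_stable] its coefficient n is already
    reached by the first n factors. *)
Definition euler : fps R := Fps (fun n => qpoch n n).

Lemma qpochS n : qpoch n.+1 = qpoch n * (1 - q ^+ n.+1).
Proof. exact: big_ord_recr. Qed.

Lemma qpoch_stable n m : (n <= m)%N -> eqX n.+1 (qpoch m) (qpoch n).
Proof.
move=> lenm; rewrite -(subnK lenm); elim: (m - n)%N => // d IH.
rewrite addSn qpochS mulrBr mulr1 -[X in eqX _ _ X]subr0.
by apply: eqXD IH _; rewrite mulrC; apply/eqXN/eqX_Xn0; lia.
Qed.

Lemma euler_qpoch n m : (n <= m.+1)%N -> eqX n euler (qpoch m).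
Proof. by move=> lenm i ltin; rewrite -[LHS](@qpoch_stable i m) //; lia. Qed.

Lemma qpoch_coef0 n : qpoch n 0%N = 1.
Proof. by rewrite (@qpoch_stable 0 n) // /qpoch big_ord0. Qed.

Lemma unit_qpoch n : qpoch n \is a GRing.unit.
Proof. exact/fps_unit1/qpoch_coef0. Qed.

Lemma unit_euler : euler \is a GRing.unit.
Proof. exact/fps_unit1/(qpoch_coef0 0). Qed.

(** The Gaussian binomial coefficients, as quotients in the ring of series, so
    that their limit in [qbin_euler] can be read off. *)
Definition qbin N k : fps R :=
  if (k <= N)%N then qpoch N / (qpoch k * qpoch (N - k)) else 0.

Lemma qbin_addE a b : qbin (a + b) a = qpoch (a + b) / (qpoch a * qpoch b).
Proof. by rewrite /qbin leq_addr addKn. Qed.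

Lemma qbin0 N : qbin N 0 = 1.
Proof. by rewrite /qbin subn0 /qpoch big_ord0 mul1r divrr ?unit_qpoch. Qed.

Lemma qbinn N : qbin N N = 1.
Proof. by rewrite /qbin leqnn subnn /qpoch big_ord0 mulr1 divrr ?unit_qpoch. Qed.

Lemma qbin_small N k : (N < k)%N -> qbin N k = 0.
Proof. by rewrite ltnNge /qbin => /negPf->. Qed.

Lemma qbin_sym N k : (k <= N)%N -> qbin N (N - k) = qbin N k.
Proof. by move=> lekN; rewrite /qbin lekN leq_subr subKn // (mulrC (qpoch k)). Qed.

Lemma qpochSV n : (qpoch n)^-1 = (1 - q ^+ n.+1) / qpoch n.+1.
Proof.
apply: (mulrI (unit_qpoch n)); rewrite divrr ?unit_qpoch // mulrA -qpochS.
by rewrite divrr ?unit_qpoch.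
Qed.

Lemma qbin_pascal N k : qbin N.+1 k.+1 = qbin N k + q ^+ k.+1 * qbin N k.+1.
Proof.
have [ltkN|ltNk|<-] := ltngtP k N; last first.
- by rewrite !qbinn (qbin_small (ltnSn _)) mulr0 addr0.
- by rewrite !qbin_small ?mulr0 ?addr0 // ltnS ltnW.
have [d ->] : exists d, N = (k.+1 + d)%N by exists (N - k.+1)%N; rewrite subnKC.
have -> : qbin (k.+1 + d) k = qbin (k + d.+1) k by rewrite addSnnS.
rewrite -addnS !qbin_addE.
have -> : qpoch (k + d.+1) = qpoch (k.+1 + d) by rewrite addSnnS.
rewrite !invrM ?unit_qpoch // (qpochSV k) (qpochSV d).
have -> : qpoch (k.+1 + d.+1) = qpoch (k.+1 + d) * (1 - q ^+ k.+1 * q ^+ d.+1).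
  by rewrite -exprD addnS qpochS.
ring.
Qed.

Lemma qbin_pascal' N k : (k <= N)%N ->
  qbin N.+1 k.+1 = qbin N k.+1 + q ^+ (N - k) * qbin N k.
Proof.
rewrite leq_eqVlt => /predU1P[<-|ltkN].
  by rewrite subnn !qbinn (qbin_small (ltnSn _)) mulr1 add0r.
rewrite -(@qbin_sym N.+1 k.+1); last by rewrite ltnS ltnW.
rewrite -(qbin_sym ltkN) -(qbin_sym (ltnW ltkN)).
by rewrite subSS -(subnSK ltkN) qbin_pascal.
Qed.

(** The triangular number T(m - k), T(x) = x(x+1)/2, extended to negative
    arguments by T(-x-1) = T(x).  Subtraction being truncated, at most one of
    the two terms is nonzero. *)
Definition tri m k := ('C(k - m, 2) + 'C(m.+1 - k, 2))%N.

Lemma tri0S m : tri m.+1 0 = (m.+1 + tri m 0)%N.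
Proof. by rewrite /tri !sub0n !subn0 binS bin1 /=; lia. Qed.

Lemma triSS m k : tri m.+1 k.+1 = tri m k.
Proof. by rewrite /tri !subSS. Qed.

Lemma triSr m k : (tri m k.+1 + m = tri m k + k)%N.
Proof.
have binS2 n : 'C(n.+1, 2) = ('C(n, 2) + n)%N by rewrite binS bin1.
rewrite /tri subSS; case: (leqP m k) => [lemk|ltkm].
  rewrite subSn // binS2 (@bin_small (m - k)) ?(@bin_small (m.+1 - k)) //; lia.
rewrite (@subSn k m) ?binS2 1?ltnW // (@bin_small (k - m)) ?(@bin_small (k.+1 - m)) //; lia.
Qed.

(** The finite form of the Jacobi triple product, as a polynomial in 'X; the
    factors with negative powers of q are cleared of their denominators:
    q^i - 'X stands for 1 - 'X q^(-i). *)
Definition jtp m n : {poly fps R} :=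
  (\prod_(i < m) ((q ^+ i.+1)%:P - 'X)) * \prod_(i < n) (1 - (q ^+ i)%:P * 'X).

Lemma jtpSl m n : jtp m.+1 n = ((q ^+ m.+1)%:P - 'X) * jtp m n.
Proof. by rewrite /jtp big_ord_recr /= mulrAC mulrC. Qed.

Lemma jtpSr m n : jtp m n.+1 = (1 - (q ^+ n)%:P * 'X) * jtp m n.
Proof. by rewrite /jtp big_ord_recr /= mulrA mulrC. Qed.

(** Each new factor has two terms and acts on the coefficients as one of the two
    Pascal rules for Gaussian binomials. *)
Lemma coef_jtp m n k :
  (jtp m n)`_k = (-1) ^+ k * q ^+ tri m k * qbin (m + n) k.
Proof.
elim: m k => [|m IHm] k.
  elim: n k => [|n IHn] k.
    rewrite /jtp !big_ord0 mulr1 coef1; case: k => [|k].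
      by rewrite qbin0 !mulr1.
    by rewrite qbin_small // mulr0.
  rewrite jtpSr mulrBl mul1r coefB -(mulrA _%:P) coefCM coefXM !IHn.
  case: k => [|k] /=; first by rewrite mulr0 subr0 !qbin0.
  rewrite !add0n; case: (leqP k n) => [lekn|ltnk].
    have E : q ^+ n * q ^+ tri 0 k = q ^+ tri 0 k.+1 * q ^+ (n - k).
      by rewrite -!exprD; congr (_ ^+ _); have := triSr 0 k; lia.
    rewrite qbin_pascal' // (exprS (-1)) !(mulrDr (_ * _)) (mulrA (_ * _) (q ^+ _)).
    rewrite -(mulrA _ (q ^+ tri 0 k.+1) (q ^+ (n - k))) -E; ring.
  by rewrite !qbin_small ?mulr0 ?subr0 // ltnW.
rewrite jtpSl mulrBl coefB coefCM coefXM !IHm.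
case: k => [|k] /=.
  by rewrite subr0 tri0S !qbin0 exprD; ring.
rewrite triSS addSn qbin_pascal.
have E : q ^+ m.+1 * q ^+ tri m k.+1 = q ^+ tri m k * q ^+ k.+1.
  by rewrite -!exprD; congr (_ ^+ _); have := triSr m k; lia.
rewrite (exprS (-1)) (mulrDr (_ * _)) (mulrA (_ * _) (q ^+ k.+1)).
rewrite -(mulrA _ (q ^+ tri m k) (q ^+ k.+1)) -E; ring.
Qed.

(** The factor 1 - 'X vanishes at 1, so only its derivative contributes there. *)
Lemma deriv_jtp n : (jtp n n.+1)^`().[1] = - (-1) ^+ n * qpoch n ^+ 2.
Proof.
have -> : jtp n n.+1 = (1 - 'X) * (\prod_(i < n) ((q ^+ i.+1)%:P - 'X)
            * \prod_(i < n) (1 - (q ^+ i.+1)%:P * 'X)).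
  by rewrite /jtp big_ord_recl expr0 polyC1 mul1r mulrCA.
set f := \prod_(i < n) _; set g := \prod_(i < n) _.
have f1 : f.[1] = (-1) ^+ n * qpoch n.
  rewrite horner_prod -[X in (-1) ^+ X](card_ord n) -prodr_const -big_split /=.
  by apply: eq_bigr => i _; rewrite !hornerE; ring.
have g1 : g.[1] = qpoch n.
  by rewrite horner_prod; apply: eq_bigr => i _; rewrite !hornerE.
rewrite derivM !hornerE f1 g1 derivB derivC derivX !hornerE subrr mul0r /=; ring.
Qed.

Lemma deriv_horner1 N (p : {poly fps R}) : (forall k, (N <= k)%N -> p`_k = 0) ->
  p^`().[1] = \sum_(k < N) p`_k *+ k.
Proof.
move=> pN; have -> : p = \poly_(k < N) p`_k.
  by apply/polyP => k; rewrite coef_poly; case: ltnP => // /pN.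
rewrite poly_def raddf_sum horner_sum; apply: eq_bigr => k _ /=.
rewrite derivZ derivXn hornerZ hornerMn hornerXn expr1n coef_sum.
rewrite (bigD1 k) //= coefZ coefXn eqxx mulr1 big1 ?addr0 ?mulr_natr // => i neik.
by rewrite coefZ coefXn eq_sym (inj_eq val_inj) (negPf neik) mulr0.
Qed.

Lemma triB n j : (j <= n)%N -> tri n (n - j) = 'C(j.+1, 2).
Proof.
by move=> lejn; rewrite /tri (@bin_small (n - j - n)) ?subSn ?leq_subr ?subKn //; lia.
Qed.

Lemma triD n j : tri n (n.+1 + j) = 'C(j.+1, 2).
Proof.
by rewrite /tri (_ : (n.+1 + j - n = j.+1)%N) ?(@bin_small (n.+1 - _)) ?addn0 //; lia.
Qed.

Definition theta N : fps R :=
  \sum_(j < N) (-1) ^+ j * (j.*2.+1)%:R * q ^+ 'C(j.+1, 2).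

(** Compare the two expressions of the derivative of [jtp n n.+1] at 1.  The
    terms of index n - j and n + 1 + j carry the same power of q and the same
    Gaussian binomial, with opposite signs, and the difference of their
    multiplicities n - j and n + 1 + j gives 2j + 1. *)
Lemma finite_jacobi n : qpoch n ^+ 2 =
  \sum_(j < n.+1) (-1) ^+ j * (j.*2.+1)%:R * (q ^+ 'C(j.+1, 2) * qbin n.*2.+1 (n - j)).
Proof.
have jtp0 k : (n.+1 + n.+1 <= k)%N -> (jtp n n.+1)`_k = 0.
  by move=> lek; rewrite coef_jtp qbin_small ?mulr0 //; lia.
apply: (mulrI (_ : - (-1) ^+ n \is a GRing.unit)).
  by rewrite unitrN unitrX ?unitrN ?unitr1.
rewrite -deriv_jtp (deriv_horner1 jtp0) big_split_ord /=.
rewrite (reindex_inj rev_ord_inj) -big_split mulr_sumr; apply: eq_bigr => -[j lejn] _ /=.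
rewrite subSS !coef_jtp triB // triD -(_ : n.*2.+1 = n + n.+1)%N; last by lia.
rewrite -(@qbin_sym _ (n.+1 + j)); last by lia.
rewrite (_ : n.*2.+1 - (n.+1 + j) = n - j)%N; last by lia.
set Q := q ^+ _; set B := qbin _ _.
have -> : (-1) ^+ (n.+1 + j) = - (-1) ^+ n * (-1) ^+ j :> fps R.
  by rewrite exprD exprS; ring.
have -> : (-1) ^+ (n - j) = (-1) ^+ n * (-1) ^+ j :> fps R.
  by rewrite -signr_odd oddB // signr_addb !signr_odd.
have -> : (j.*2.+1)%:R = j%:R + j%:R + 1 :> fps R by rewrite -addnn -addn1 !natrD.
rewrite -(mulr_natr _ (n - j)) -(mulr_natr _ (n.+1 + j)) natrB // natrD mulrS; ring.
Qed.

Lemma qbin_euler a b : (a <= b)%N -> eqX a.+1 (qbin (a + b) a * euler) 1.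
Proof.
move=> leab; rewrite qbin_addE -(divrr (unit_qpoch b)).
have -> : qpoch b / qpoch b = qpoch b / (qpoch a * qpoch b) * qpoch a.
  by rewrite invrM ?unit_qpoch // !mulrA mulrVK ?unit_qpoch.
apply: eqXM; last exact: euler_qpoch.
apply: eqXM => //; apply: eqX_trans (qpoch_stable (leq_addr _ _)) _.
exact/eqX_sym/qpoch_stable.
Qed.

(** Multiply [finite_jacobi] by the Euler product: by [qbin_euler] the Gaussian
    binomial is then 1 modulo q^(n-j+1), and the accompanying q^(j(j+1)/2),
    whose exponent is at least j, raises this to a congruence modulo q^(n+1). *)
Lemma jacobi N : eqX N (euler ^+ 3) (theta N).
Proof.
case: N => // n; rewrite exprS.
apply: eqX_trans (eqXM (@eqX_refl _ n.+1 euler) (eqXX 2 (@euler_qpoch _ n _))) _ => //.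
rewrite finite_jacobi mulr_sumr; apply: eqX_sum => -[j lejn] _ /=.
rewrite mulrCA; apply: eqXM => //.
rewrite -[X in eqX _ _ X]mulr1 mulrCA (mulrC euler); set T := 'C(_, 2).
apply: (@eqX_leq _ _ (T + (n - j).+1)).
  have : (j <= T)%N by rewrite /T binS bin1; lia.
  lia.

apply: eqX_Xn; rewrite (_ : n.*2.+1 = (n - j) + (n.+1 + j))%N; last lia.
by apply: qbin_euler; lia.
Qed.

Lemma bin2_triple M : [/\ 'C(3 * M + 1, 2) = 9 * 'C(M, 2) + 6 * M,
  'C(3 * M + 2, 2) = 9 * 'C(M.+1, 2) + 1 & 'C(3 * M + 3, 2) = 9 * 'C(M, 2) + 12 * M + 3]%N.
Proof.
have binS2 n : 'C(n.+1, 2) = ('C(n, 2) + n)%N by rewrite binS bin1.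
have C3M : 'C(3 * M, 2) = (9 * 'C(M, 2) + 3 * M)%N.
  by elim: M => // M IH; rewrite mulnS !addSn !binS2 IH; lia.
by rewrite !addnS addn0 !binS2 C3M; split; lia.
Qed.

(** Grouping the terms by j mod 3 lets [bin2_triple] decide which of them each
    trisection operator keeps. *)
Lemma theta3S M : theta (3 * M.+1) = theta (3 * M) + \sum_(s < 3)
  (-1) ^+ (3 * M + s) * ((3 * M + s).*2.+1)%:R * q ^+ 'C(3 * M + s.+1, 2).
Proof.
rewrite /theta mulnS !addSn add0n !big_ord_recr big_ord0 /=.
by rewrite add0r !addrA !addnS !addn0.
Qed.

Lemma Uop_constM r n j (f : fps R) : (r < 3)%N ->
  Uop r ((-1) ^+ j * n%:R * f) = (-1) ^+ j * n%:R * Uop r f.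
Proof.
move=> ltr; have cE : Vop ((-1) ^+ j * n%:R) = (-1) ^+ j * n%:R :> fps R.
  by rewrite rmorphM rmorphXn rmorphN1 rmorph_nat.
by rewrite -[in LHS]cE UopVM.
Qed.

Lemma Uop1_theta M : Uop 1 (theta (3 * M)) = - 3%:R * Vop (theta M).
Proof.
elim: M => [|M IH]; first by rewrite /theta !big_ord0 !raddf0 mulr0.
have [E0 E1 E2] := bin2_triple M.
rewrite theta3S raddfD /= IH !big_ord_recr big_ord0 /= add0r !raddfD /=.
rewrite !Uop_constM // E0 E1 E2 !Uop_Xn //.
have -> : ((9 * 'C(M, 2) + 6 * M) %% 3 = 0)%N by lia.
have -> : ((9 * 'C(M.+1, 2) + 1) %% 3 = 1)%N by lia.
have -> : ((9 * 'C(M, 2) + 12 * M + 3) %% 3 = 0)%N by lia.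
rewrite /= !mulr0 add0r addr0.
rewrite /theta big_ord_recr /= rmorphD mulrDr; congr (_ + _).
rewrite !rmorphM !rmorphXn rmorphN1 rmorph_nat /= VopX -exprM.
rewrite (_ : (9 * _ + 1) %/ 3 = 3 * 'C(M.+1, 2))%N; last lia.
rewrite (_ : (3 * M + 1).*2.+1 = 3 * (M.*2.+1))%N; last lia.
rewrite natrM -(signr_odd _ (3 * M + 1)) oddD oddM /= addbT signrN signr_odd; ring.
Qed.

Lemma Uop2_theta M : Uop 2 (theta (3 * M)) = 0.
Proof.
elim: M => [|M IH]; first by rewrite /theta !big_ord0 !raddf0.
have [E0 E1 E2] := bin2_triple M.
rewrite theta3S raddfD /= IH !big_ord_recr big_ord0 /= !add0r !raddfD /=.
by rewrite !Uop_constM // E0 E1 E2 !Uop_Xn // !ifF ?mulr0 ?addr0; try lia.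
Qed.

Local Notation e := euler.
Local Notation t := (Vop euler).
Local Notation P := (Uop 0 (euler ^+ 3)).

Lemma euler_cube : e ^+ 3 = Vop P - 3%:R * q * Vop (t ^+ 3).
Proof.
rewrite {1}[e ^+ 3]trisection.
have -> : Uop 1 (e ^+ 3) = - 3%:R * t ^+ 3.
  apply: eqX_all => M; apply: eqX_trans (eqX_Uop _ (@jacobi (3 * M))) _ => //.
  rewrite Uop1_theta -rmorphXn; apply: eqXM => //.
  exact/eqX_Vop/eqX_sym/jacobi.
have -> : Uop 2 (e ^+ 3) = 0.
  apply: eqX_all => M; apply: eqX_trans (eqX_Uop _ (@jacobi (3 * M))) _ => //.
  by rewrite Uop2_theta.
by rewrite raddf0 rmorphM rmorphN rmorph_nat; ring.
Qed.

(** Among 1 - q^(3M+1), 1 - q^(3M+2), 1 - q^(3M+3) the first two are fixed by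
    the norm, and the last one, a series in q^3, is sent to
    (1 - q^(M+1))^3. *)
Lemma norm3_qpoch M :
  norm3 (qpoch (3 * M)) * Vop (qpoch M) = qpoch (3 * M) * qpoch M ^+ 3.
Proof.
elim: M => [|M IH].
  have q0 : qpoch 0 = 1 by rewrite /qpoch big_ord0.
  by rewrite muln0 q0 -{1}(rmorph1 (@Vop R)) norm3V rmorph1 !expr1n !mulr1.
rewrite mulnS !addSn add0n !qpochS !norm3M rmorphM rmorphB rmorph1 rmorphXn /= VopX.
rewrite -exprM mulnS !addSn add0n.
rewrite (@norm3_1BX _ (3 * M).+1) ?(@norm3_1BX _ (3 * M).+2); try lia.
have -> : norm3 (1 - q ^+ (3 * M).+3) = (1 - q ^+ M.+1) ^+ 3.
  rewrite -norm3V rmorphB rmorph1 rmorphXn /= VopX -exprM.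
  by congr (norm3 (_ - _ ^+ _)); lia.
ring: IH.
Qed.

(** For z a primitive cube root of unity, E_1(q) E_1(zq) E_1(z^2 q) is
    E_3^4 / E_9; here q^3 has been renamed q. *)
Lemma norm3_euler : norm3 e * t = e ^+ 4.
Proof.
apply: eqX_all => M; apply: (@eqX_trans _ _ _ (norm3 (qpoch (3 * M)) * Vop (qpoch M))).
  apply: eqXM; first by apply/eqX_norm3/euler_qpoch; lia.
  exact/eqX_Vop/euler_qpoch.
rewrite norm3_qpoch (exprS e 3); apply/eqX_sym/eqXM; last exact/eqXX/euler_qpoch.
by apply: euler_qpoch; lia.
Qed.

(** The norm of E_1^3, in closed form E_1^12 / E_3^3. *)
Definition cubenorm := P ^+ 3 - 27%:R * q * t ^+ 9.
Local Notation K := cubenorm.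

Lemma cubenormE : K = norm3 (e ^+ 3).
Proof.
have eE : e ^+ 3 = Vop P + q * Vop (- 3%:R * t ^+ 3) + q ^+ 2 * Vop 0.
  rewrite {1}euler_cube raddf0 (rmorphM (@Vop R) (- _)) rmorphN rmorph_nat /=; ring.
have [E0 E1 E2] := trisectE eE; rewrite /norm3 E1 E2 /K; ring.
Qed.

Lemma cubenorm_euler : K * t ^+ 3 = e ^+ 12.
Proof.
rewrite cubenormE -[12%N]/(4 * 3)%N exprM -norm3_euler.
by rewrite (_ : e ^+ 3 = e * e * e) ?norm3M ?norm3M; ring.
Qed.

(** The factorization (a - b)(a^2 + ab + b^2) = a^3 - b^3, where a^3 and b^3 are
    series in q^3; it plays the role of a formula for 1 / E_1^3. *)
Lemma cube_cofactor :
  e ^+ 3 * (Vop P ^+ 2 + Vop P * (3%:R * q * Vop (t ^+ 3)) + (3%:R * q * Vop (t ^+ 3)) ^+ 2)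
  = Vop K.
Proof.
rewrite {1}euler_cube /K rmorphB !(rmorphXn, rmorphM) !rmorph_nat /= VopX; ring.
Qed.

End Euler.

(** * The generating function of restricted colored partitions *)

Section GF.
Variable R : comNzRingType.
Local Notation q := (fpsX R).
Local Notation e := (euler R).
Local Notation t := (Vop (euler R)).
Local Notation P := (Uop 0 (euler R ^+ 3)).
Local Notation K := (cubenorm R).

Definition part_gf l t i : fps R :=
  \sum_(a < t | (l %| i.+1)%N ==> (a == 0 :> nat)) q ^+ (a * i.+1).

(** Expanding the product over all pairs (part, color) gives one monomial for
    each choice of multiplicities. *)
Lemma coef_prod_part_gf k l t n :
  (\prod_(i < n) part_gf l t i ^+ k) n = (RD k l t n)%:R.
Proof.
pose ok (x : 'I_n * 'I_k) (a : 'I_t) := (l %| x.1.+1)%N ==> (a == 0 :> nat).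
have -> : \prod_(i < n) part_gf l t i ^+ k =
    \prod_x \sum_(a : 'I_t) if ok x a then q ^+ (a * x.1.+1) else 0.
  rewrite -(pair_bigA _ (fun i c => \sum_a if ok (i, c) a then q ^+ (a * i.+1) else 0)) /=.
  apply: eq_bigr => i _; rewrite -[X in _ ^+ X]card_ord -prodr_const.
  by apply: eq_bigr => c _; rewrite /part_gf big_mkcond.
rewrite bigA_distr_bigA coefs_sum /RD -sum1_card natr_sum [RHS]big_mkcond.
apply: eq_bigr => f _ /=; rewrite inE.
have <- : [forall x, ok x (f x)] =
    [forall i : 'I_n, forall c : 'I_k, (l %| i.+1)%N ==> (f (i, c) == 0 :> nat)].
  apply/forallP/forallP => [okf i | okf [i c]]; last exact: (forallP (okf i)).
  by apply/forallP => c; apply: (okf (i, c)).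
case: forallP => [okf | nok]; last first.
  rewrite andbF; have /forallPn[x /negPf xN] : ~~ [forall x, ok x (f x)] by apply/forallP.
  by rewrite (_ : \prod_y _ = 0) ?coefs0 // (bigD1 x) //= xN mul0r.
rewrite andbT (eq_bigr (fun x => q ^+ (f x * x.1.+1))) => [|x _]; last by rewrite okf.
have -> : (\sum_(i < n) \sum_(c < k) f (i, c) * i.+1 = \sum_x f x * x.1.+1)%N.
  by rewrite pair_bigA; apply: eq_bigr => -[].
rewrite prodrXr coefsXn.
by rewrite eq_sym; case: eqP.
Qed.

Lemma Vop_mul1BX (f : fps R) n : Vop (f * (1 - q ^+ n)) = Vop f * (1 - q ^+ (3 * n)).
Proof. by rewrite (rmorphM (@Vop R) f) rmorphB rmorph1 /= VopXn. Qed.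

(** The one-color identity: E_3^2 / (E_1 E_9) generates the one-color partitions.
    On the factors of index below 3M, a part prime to 3 contributes
    (1 - x^3) / (1 - x) and a multiple of 3 contributes 1. *)
Lemma finite_gf M :
  \prod_(i < 3 * M) part_gf 3 3 i * (qpoch R (3 * M) * Vop (Vop (qpoch R M)))
  = Vop (qpoch R (3 * M)) * Vop (qpoch R M).
Proof.
elim: M => [|M IH].
  by rewrite muln0 /qpoch !big_ord0 !rmorph1 !mulr1.
have part_no i : ~~ (3 %| i.+1)%N -> part_gf 3 3 i = 1 + q ^+ i.+1 + (q ^+ i.+1) ^+ 2.
  rewrite /part_gf => /negPf ->; rewrite !big_ord_recr big_ord0 /= add0r mul0n expr0.
  by rewrite mul1n mulnC exprM.
have part_3 i : (3 %| i.+1)%N -> part_gf 3 3 i = 1.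
  by rewrite /part_gf => ->; rewrite !big_mkcond !big_ord_recr big_ord0 /= !addr0 add0r mul0n.
rewrite mulnS !addSn add0n !qpochS !big_ord_recr /=.
rewrite (part_3 (3 * M).+2) ?(part_no (3 * M)%N) ?(part_no (3 * M).+1); try lia.
rewrite !Vop_mul1BX.
rewrite (_ : 3 * (3 * M.+1) = (3 * M).+3 * 3)%N; last lia.
rewrite (_ : 3 * (3 * M).+1 = (3 * M).+1 * 3)%N; last lia.
rewrite (_ : 3 * (3 * M).+2 = (3 * M).+2 * 3)%N; last lia.
rewrite (_ : 3 * (3 * M).+3 = (3 * M).+3 * 3)%N; last lia.
rewrite (_ : 3 * M.+1 = (3 * M).+3)%N; last lia.
rewrite !exprM.
ring: IH.
Qed.

Definition RDgf k l t : fps R := Fps (fun n => (RD k l t n)%:R).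

Lemma part_gf_eq1 l t i : (0 < t)%N -> eqX i.+1 (part_gf l t i) 1.
Proof.
case: t => // t' _ n ltni; rewrite /part_gf (bigD1 ord0) ?implybT // mul0n expr0.
rewrite coefsD coefs_sum big1 ?addr0 // => a /andP[_ a_neq0].
rewrite coefsXn ltn_eqF // (leq_trans ltni) // leq_pmull // lt0n.
exact: a_neq0.
Qed.

Lemma RDgf_prod k l t N : (0 < t)%N ->
  eqX N.+1 (RDgf k l t) (\prod_(i < N) part_gf l t i ^+ k).
Proof.
move=> t_gt0 n ltnN.
have stable d : eqX n.+1 (\prod_(i < n) part_gf l t i ^+ k)
                         (\prod_(i < n + d) part_gf l t i ^+ k).
  elim: d => [|d IH]; first by rewrite addn0.
  rewrite addnS big_ord_recr -[X in eqX _ X _]mulr1; apply: eqXM => //.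
  rewrite -(expr1n _ k); apply/eqXX/eqX_sym; apply: (@eqX_leq _ _ (n + d).+1); first lia.
  exact: part_gf_eq1.
rewrite -[LHS]/(_%:R) -coef_prod_part_gf -(subnKC (ltnSE ltnN)).
exact: stable.
Qed.

Lemma RDgf_euler : RDgf 3 3 3 * (e * Vop t) ^+ 3 = t ^+ 6.
Proof.
apply: eqX_all => M.
apply: (@eqX_trans _ _ _ ((\prod_(i < 3 * M) part_gf 3 3 i) ^+ 3 *
   (qpoch R (3 * M) * Vop (Vop (qpoch R M))) ^+ 3)).
  apply: eqXM.
    apply: (@eqX_leq _ _ (3 * M).+1); first lia.
    by rewrite -prodrXl; apply: RDgf_prod.
  apply/eqXX/eqXM; first by apply: euler_qpoch; lia.
  exact/eqX_Vop/eqX_Vop/euler_qpoch.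
rewrite -exprMn finite_gf -[6%N]/(2 * 3)%N (exprM t); apply/eqX_sym/eqXX.
rewrite expr2; apply/eqXM; apply/eqX_Vop/euler_qpoch; lia.
Qed.

(** * The action of the trisection operators *)

Lemma unit_Vop_euler : t \is a GRing.unit.
Proof. exact/(rmorph_unit (@Vop R))/unit_euler. Qed.

Lemma unit_cubenorm : K \is a GRing.unit.
Proof.
have : K * t ^+ 3 \is a GRing.unit by rewrite cubenorm_euler unitrX ?unit_euler.
by rewrite unitrM => /andP[].
Qed.

Definition eta6 : fps R := t ^+ 6 / e ^+ 6.
(** 27 q (E_3/E_1)^12, that is 27 times a Hauptmodul of Gamma_0(3).  With the
    factor 27 included, U_1 becomes divisible by 3 on integer polynomials in
    it. *)
Definition hauptmodul27 : fps R := 27%:R * q * t ^+ 9 / K.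
Local Notation y := eta6.
Local Notation w := hauptmodul27.

Lemma eta6E : y * e ^+ 6 = t ^+ 6.
Proof. by rewrite divrK // unitrX ?unit_euler. Qed.

Lemma hauptmodul27E : w * K = 27%:R * q * t ^+ 9.
Proof. by rewrite divrK // unit_cubenorm. Qed.

Local Notation S :=
  (Vop P ^+ 2 + Vop P * (3%:R * q * Vop (t ^+ 3)) + (3%:R * q * Vop (t ^+ 3)) ^+ 2).

(** Since F V(K E_3^3) = V(E_1^6) (a^2 + ab + b^2), only b^2 = 9 q^2 E_9^6 is
    seen by U_2. *)
Lemma Uop2_RDgf : Uop 2 (RDgf 3 3 3) = 9%:R * y.
Proof.
have FK : Vop (K * t ^+ 3) * RDgf 3 3 3 = Vop (e ^+ 6) * S.
  rewrite (rmorphM (@Vop R)) /= -(cube_cofactor R) !(rmorphXn (@Vop R)) /= -RDgf_euler; ring.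
have SE : S = Vop (P ^+ 2) + q * Vop (3%:R * P * t ^+ 3) + q ^+ 2 * Vop (9%:R * t ^+ 6).
  rewrite !(rmorphXn (@Vop R), rmorphM (@Vop R)) !rmorph_nat /=; ring.
have := congr1 (Uop 2) FK; rewrite !UopVM //; have [_ _ ->] := trisectE SE.
rewrite cubenorm_euler -eta6E => U2; apply: (@mulrI _ (e ^+ 12)).
  by rewrite unitrX ?unit_euler.
by rewrite U2; ring.
Qed.

Definition evalw (p : {poly int}) : fps R := (map_poly intr p).[w].

Lemma evalw0 : evalw 0 = 0.
Proof. by rewrite /evalw rmorph0 horner0. Qed.

Lemma evalw1 : evalw 1 = 1.
Proof. by rewrite /evalw rmorph1 hornerC. Qed.

Lemma evalwD p1 p2 : evalw (p1 + p2) = evalw p1 + evalw p2.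
Proof. by rewrite /evalw rmorphD hornerD. Qed.

Lemma evalwZ a p : evalw (a *: p) = a%:~R * evalw p.
Proof. by rewrite /evalw map_polyZ hornerZ. Qed.

(** A monomial in the expansion of y w^j, cleared of its denominators.  It
    survives when j + m = 3l + 1; then n = 3N with N + l = 3j + 1, and
    P^3 = K (1 + w) turns it into 3 y 9^j w^l (1 + w)^N. *)
Lemma Uop1_monomial j n m : (n + m = 4 + 8 * j)%N -> exists p,
  e ^+ (6 + 12 * j) * Uop 1 ((27%:R * q) ^+ j *
     (Vop P ^+ n * (3%:R * q * Vop (t ^+ 3)) ^+ m))
  = K ^+ (2 + 4 * j) * (3%:R * (y * evalw p)).
Proof.
move=> nm.
have -> : (27%:R * q) ^+ j * (Vop P ^+ n * (3%:R * q * Vop (t ^+ 3)) ^+ m) =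
    Vop (27%:R ^+ j * 3%:R ^+ m * P ^+ n * (t ^+ 3) ^+ m) * q ^+ (j + m).
  rewrite !(rmorphXn (@Vop R), rmorphM (@Vop R)) !rmorph_nat /= !exprMn exprD; ring.
rewrite UopVM // Uop_Xn //; case: eqP => [jm|_]; last first.
  by exists 0; rewrite evalw0 !mulr0.
set l := ((j + m) %/ 3)%N.
have [N NE] : exists N, (N + l = 3 * j + 1)%N by exists (3 * j + 1 - l)%N; lia.
have {}jm : (j + m = 3 * l + 1)%N by lia.
have {}nm : (n = 3 * N)%N by lia.
exists ((9 ^+ j)%:P * 'X ^+ l * (1 + 'X) ^+ N).
have -> : evalw ((9 ^+ j)%:P * 'X ^+ l * (1 + 'X) ^+ N) = 9%:R ^+ j * w ^+ l * (1 + w) ^+ N.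
  rewrite /evalw !rmorphM /= map_polyC !rmorphXn rmorphD rmorph1 /= map_polyX.
  by rewrite !hornerE rmorphXn /= rmorph_nat.
have PK : P ^+ 3 = K * (1 + w) by rewrite mulrDr mulr1 (mulrC K w) hauptmodul27E /K; ring.
have u : e ^+ 6 * t ^+ (3 * j) \is a GRing.unit.
  by rewrite unitrM !unitrX ?unit_euler ?unit_Vop_euler.
(* The unit u clears the denominators of y and makes the exponent of t, which
   is 3 + 3(3l - j), a sum of natural numbers. *)
apply: (mulIr u).
have tE : t ^+ 3 ^+ m * t ^+ (3 * j) = (t ^+ 9) ^+ l * t ^+ 3.
  by rewrite -!exprM -!exprD; congr (_ ^+ _); lia.
have eE : e ^+ (6 + 12 * j) * e ^+ 6 = K ^+ j.+1 * (t ^+ 3 * t ^+ (3 * j)).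
  rewrite -exprD (_ : (_ + _ = 12 * j.+1)%N); last lia.
  by rewrite exprM -cubenorm_euler exprMn -exprD -!exprM; congr (_ * _ ^+ _); lia.
(* The only place where powers of 3 are counted: 3j + m = 1 + 2j + 3l. *)
have cE : 27%:R ^+ j * 3%:R ^+ m = 3%:R * 9%:R ^+ j * 27%:R ^+ l :> fps R.
  rewrite -!natrX -!natrM; congr (_%:R).
  rewrite (_ : 27 = 3 ^ 3)%N // (_ : 9 = 3 ^ 2)%N // -!expnM -!expnD -expnS -expnD.
  by congr (_ ^ _)%N; lia.
have wE : 27%:R ^+ l * q ^+ l * (t ^+ 9) ^+ l = w ^+ l * K ^+ l.
  by rewrite -!exprMn hauptmodul27E.
have KE : K ^+ (2 + 4 * j) = K ^+ N * K ^+ l * K ^+ j.+1.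
  by rewrite -!exprD; congr (_ ^+ _); lia.
rewrite nm (exprM P) PK exprMn KE cE.
transitivity (3%:R * 9%:R ^+ j * (27%:R ^+ l * q ^+ l) * (K ^+ N * (1 + w) ^+ N)
   * (t ^+ 3 ^+ m * t ^+ (3 * j)) * (e ^+ (6 + 12 * j) * e ^+ 6)); first by ring.
rewrite tE eE.
transitivity (3%:R * 9%:R ^+ j * (27%:R ^+ l * q ^+ l * t ^+ 9 ^+ l) * (K ^+ N * (1 + w) ^+ N)
   * t ^+ 6 * K ^+ j.+1 * t ^+ (3 * j)); first by ring.
by rewrite wE -eta6E; ring.
Qed.

(** The numerator of y w^j over a power of E_1^3, the factors E_3 in it being
    series in q^3. *)
Lemma eta6_hauptmodul27 j : e ^+ (6 + 12 * j) * (y * w ^+ j) = t ^+ (6 + 12 * j) * (27%:R * q) ^+ j.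
Proof.
move: eta6E hauptmodul27E (cubenorm_euler R); move: y w K q e t => Y W k x u s.
move=> YE WE kE; have we : W * u ^+ 12 = 27%:R * x * s ^+ 12.
  by rewrite -kE mulrA WE; ring.
transitivity (Y * u ^+ 6 * (W * u ^+ 12) ^+ j).
  by rewrite (exprMn _ W) (exprD u) (exprM u); ring.
by rewrite YE we exprMn (exprD s) (exprM s); ring.
Qed.

Lemma trinomial_expand (A : comNzRingType) (a b : A) s :
  (a ^+ 2 + a * b + b ^+ 2) ^+ s = \sum_(f : {ffun 'I_s -> 'I_3})
     a ^+ (\sum_i (2 - f i)) * b ^+ (\sum_i f i).
Proof.
have -> : a ^+ 2 + a * b + b ^+ 2 = \sum_(i < 3) a ^+ (2 - i) * b ^+ i.
  by rewrite !big_ord_recr big_ord0 /=; ring.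
rewrite -[X in _ ^+ X](card_ord s) -prodr_const bigA_distr_bigA /=.
by apply: eq_bigr => f _; rewrite big_split /= !prodrXr.
Qed.

(** The exponent 2 + 4j is that of the power E_1^(6+12j) of E_1^3 in the
    denominator of y w^j; by [cube_cofactor] dividing by it amounts to
    multiplying by (a^2 + ab + b^2)^(2+4j) and dividing by a series in q^3. *)
Lemma Uop1_hauptmodul27 j : exists p, Uop 1 (y * w ^+ j) = 3%:R * (y * evalw p).
Proof.
set s := (2 + 4 * j)%N.
have fE : Vop (K ^+ s) * (y * w ^+ j) = Vop (e ^+ (6 + 12 * j)) * ((27%:R * q) ^+ j * S ^+ s).
  rewrite (rmorphXn (@Vop R) s K) /= -cube_cofactor exprMn -exprM.
  have -> : (3 * s = 6 + 12 * j)%N by rewrite /s; lia.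
  rewrite (rmorphXn (@Vop R) (6 + 12 * j) e) /=.
  have aux (a b c d Z : fps R) : a * b = c * d -> a * Z * b = c * (d * Z).
    by move=> abcd; rewrite mulrAC abcd mulrA.
  exact: aux (eta6_hauptmodul27 j).
have := congr1 (Uop 1) fE; rewrite !UopVM // => UE.
suff [p pE] : exists p, e ^+ (6 + 12 * j) * Uop 1 ((27%:R * q) ^+ j * S ^+ s)
    = K ^+ s * (3%:R * (y * evalw p)).
  by exists p; apply: (@mulrI _ (K ^+ s)); rewrite ?unitrX ?unit_cubenorm // UE.
rewrite trinomial_expand mulr_sumr raddf_sum mulr_sumr /=.
apply: (big_ind (fun f => exists p, f = K ^+ s * (3%:R * (y * evalw p)))).
- by exists 0; rewrite evalw0 !mulr0.
- by move=> _ _ [p1 ->] [p2 ->]; exists (p1 + p2); rewrite evalwD; ring.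
move=> f _; apply: Uop1_monomial.
rewrite -big_split /= (eq_bigr (fun=> 2%N)) => [|i _]; last by rewrite subnK // -ltnS.
by rewrite sum_nat_const card_ord /s; lia.
Qed.

Lemma Uop1_stable p : exists p', Uop 1 (y * evalw p) = 3%:R * (y * evalw p').
Proof.
have -> : y * evalw p = \sum_(i < size p) (p`_i)%:~R * (y * w ^+ i).
  rewrite /evalw horner_poly mulr_sumr; apply: eq_bigr => i _.
  ring.
rewrite raddf_sum /=.
apply: (big_ind (fun f => exists p', f = 3%:R * (y * evalw p'))).
- by exists 0; rewrite evalw0 !mulr0.
- by move=> _ _ [p1 ->] [p2 ->]; exists (p1 + p2); rewrite evalwD; ring.
move=> i _; have [p' E] := Uop1_hauptmodul27 i; exists (p`_i *: p').
rewrite mulrzl raddfMz /= E evalwZ -mulrzl; ring.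
Qed.

Lemma iter_Uop1_RDgf k : exists p,
  iter k (Uop 1) (Uop 2 (RDgf 3 3 3)) = 3%:R ^+ k.+2 * (y * evalw p).
Proof.
elim: k => [|k [p IH]].
  by exists 1; rewrite [LHS]Uop2_RDgf evalw1; ring.
rewrite iterS IH; have [p' E] := Uop1_stable p; exists p'.
rewrite -natrX mulr_natl raddfMn /= E -(mulr_natl _ (3 ^ k.+2)%N) natrX !exprS; ring.
Qed.

(** Iterating n -> 3n + 1 starts the progression at 1 + 3 + ... + 3^(k-1). *)
Lemma coef_iter_Uop1 k (f : fps R) n : iter k (Uop 1) f n = f (3 ^ k * n + (3 ^ k).-1 %/ 2)%N.
Proof.
elim: k f n => [|k IH] f n; first by rewrite mul1n addn0.
rewrite iterSr IH coefsU; congr (f _); rewrite expnS.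
have : odd (3 ^ k) by rewrite oddX orbT.
lia.
Qed.

End GF.

Lemma dvdn_RD k n :
  (3 ^ k.+2 %| RD 3 3 3 (3 ^ k.+1 * n + (3 ^ k.+1 + 1) %/ 2))%N.
Proof.
have [p /(congr1 (fun f : fps int => f n))] := iter_Uop1_RDgf int k.
rewrite coef_iter_Uop1 coefsU -[LHS]/(_%:R) -natrX mulr_natl coefsMn -(mulr_natl _ (3 ^ k.+2)%N).
have -> : (3 * (3 ^ k * n + (3 ^ k).-1 %/ 2) + 2 = 3 ^ k.+1 * n + (3 ^ k.+1 + 1) %/ 2)%N.
  have : odd (3 ^ k) by rewrite oddX orbT.
  by rewrite expnS; lia.
rewrite !natz => E.
have : ((3 ^ k.+2)%N%:Z %| (RD 3 3 3 (3 ^ k.+1 * n + (3 ^ k.+1 + 1) %/ 2))%:Z)%Z.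
  by rewrite E dvdz_mulr.
by [].
Qed.

Local Close Scope ring_scope.

Theorem corollary1p2 (k n : nat) (hk : 1 <= k) :
  RD 3 3 3 (3 ^ k * n + (3 ^ k + 1) %/ 2) = 0 %[mod 3 ^ (k + 1)].
Proof.
case: k hk => // k _; apply/eqP; rewrite mod0n (addn1 k.+1); exact: dvdn_RD.
Qed.
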